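(* Let $\mathcal{Z}=\mathcal{S}(\{Z_1,\ldots,Z_r\})$ be an involutive distribution of rank $r<n$ on an open set $U\subset\mathbb{R}^n$. Assume that the $\mathcal{C}^{\infty}$-structure $\langle X_1,\ldots,X_{n-r}\rangle$ for $\mathcal{Z}$ and the $\mathcal{C}^{\infty}$-structure of 1-forms $\langle\omega_1,\ldots,\omega_{n-r}\rangle$ for $\mathcal{Z}$ are $\mathcal{Z}$-related. Then, for any $i_0\in\{1,\ldots,n-r\}$, a non-vanishing smooth function $f_{i_0}$ on $U$ is a symmetrizing factor for $X_{i_0}$ with respect to $\mathcal{S}(\mathcal{X}_{i_0-1})$ if and only if the function $\mu_{i_0}=1/(f_{i_0}X_{i_0}\,\lrcorner\,\omega_{i_0})$ is an $\mathcal{S}(\Lambda_{i_0})$-integrating factor for $\omega_{i_0}$.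
   Context: $\lrcorner$ denotes contraction (interior product) of a vector field with a differential form. Vector fields (or 1-forms) are called independent on $U$ if they are pointwise linearly independent at every point of $U$. $\mathcal{S}(B)$ denotes the $\mathcal{C}^\infty(U)$-submodule of the smooth vector fields (or 1-forms) on $U$ generated by $B$, and, for a set $B$ of 1-forms, $\mathcal{I}(B)$ denotes the algebraic ideal generated by $B$ in the exterior algebra $\Omega^*(U)$ of differential forms (so $\mathcal{I}(\emptyset)=0$); a differential ideal is an ideal closed under the exterior derivative $d$. A rank $r$ distribution on $U$ is a submodule $\mathcal{S}(\{Z_1,\ldots,Z_r\})$ with $Z_1,\ldots,Z_r$ independent vector fields; it is involutive if closed under the Lie bracket. For a distribution $\mathcal{D}$, $\mathcal{D}^{\circ}$ is the module of 1-forms $\omega$ on $U$ with $Z\,\lrcorner\,\omega=0$ for all $Z\in\mathcal{D}$. Symmetries. Let $\mathcal{D}=\mathcal{S}(\{D_1,\ldots,D_s\})$ be an involutive distribution of rank $s<n$. A vector field $X$ with $\{D_1,\ldots,D_s,X\}$ independent on $U$ is a $\mathcal{C}^{\infty}$-symmetry of $\mathcal{D}$ if $\mathcal{S}(\{D_1,\ldots,D_s,X\})$ is involutive, i.e. $[X,D_i]=\lambda_iX+\sum_{k}c_{ik}D_k$ for $1\le i\le s$, with smooth $\lambda_i,c_{ik}$; it is a symmetry of $\mathcal{D}$ if moreover all $\lambda_i=0$. A non-vanishing smooth function $f$ is a symmetrizing factor of a $\mathcal{C}^\infty$-symmetry $X$ with respect to $\mathcal{D}$ if $fX$ is a symmetry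 of $\mathcal{D}$. $\mathcal{C}^\infty$-structures. For an ordered collection $\langle X_1,\ldots,X_{n-r}\rangle$ of vector fields put $\mathcal{X}_0=\{Z_1,\ldots,Z_r\}$ and $\mathcal{X}_k=\{Z_1,\ldots,Z_r,X_1,\ldots,X_k\}$ for $1\le k\le n-r$. It is a $\mathcal{C}^{\infty}$-structure for $\mathcal{Z}$ if, for each $1\le k\le n-r$, $X_k$ is a $\mathcal{C}^\infty$-symmetry of the rank $r+k-1$ distribution $\mathcal{S}(\mathcal{X}_{k-1})$. For an ordered collection $\langle\omega_1,\ldots,\omega_{n-r}\rangle$ of independent 1-forms put $\Lambda_k=\{\omega_{k+1},\ldots,\omega_{n-r}\}$ for $0\le k\le n-r-1$ and $\Lambda_{n-r}=\emptyset$. It is a $\mathcal{C}^{\infty}$-structure of 1-forms for $\mathcal{Z}$ if $\mathcal{S}(\Lambda_0)=\mathcal{Z}^{\circ}$ and $\mathcal{I}(\Lambda_k)$ is a differential ideal for $k=1,\ldots,n-r-1$. The two structures are $\mathcal{Z}$-related if $\mathcal{S}(\mathcal{X}_k)^{\circ}=\mathcal{S}(\Lambda_k)$ for $0\le k\le n-r-1$. In this case each function $X_{i}\,\lrcorner\,\omega_{i}$ vanishes nowhere on $U$, so $\mu_{i_0}$ above is well defined. Relative integrating factors. A non-vanishing smooth function $\mu$ on $U$ is an $\mathcal{S}(\Lambda_{i_0})$-integrating factor of $\omega_{i_0}$ if $d(\mu\omega_{i_0})\in\mathcal{I}(\Lambda_{i_0})$; for $i_0=n-r$ this means $d(\mu\omega_{n-r})=0$.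 *)

(* Defs.v *)
From HB Require Import structures.
From mathcomp Require Import all_boot all_order all_algebra.
From mathcomp Require Import all_classical all_reals all_analysis.

Set Implicit Arguments.
Unset Strict Implicit.
Unset Printing Implicit Defensive.

Import Order.TTheory GRing.Theory Num.Theory.
Import numFieldNormedType.Exports.

Local Open Scope classical_set_scope.
Local Open Scope ring_scope.

(* Functions, vector fields and differential forms on an open set U of R^n are
   total maps on 'rV[R]_n of which only the restriction to U is ever used:
   every notion below mentions values and derivatives at points of U only, so
   (U being open) membership in the sets smspan, annihilator and form_ideal is
   unaffected by changes off U, and equality of such sets is equality of the
   corresponding modules or ideals on U. *)

Definition partial (R : realType) (n : nat) (i : 'I_n) (f : 'rV[R]_n -> R) :
  'rV[R]_n -> R := fun x => 'D_(delta_mx 0 i) f x.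

Fixpoint Cdiff (R : realType) (n : nat) (U : set 'rV[R]_n) (k : nat)
    (f : 'rV[R]_n -> R) : Prop :=
  match k with
  | 0 => forall x, U x -> {for x, continuous f}
  | k'.+1 => (forall x, U x -> differentiable f x) /\
             (forall i : 'I_n, Cdiff U k' (partial i f))
  end.

Definition smooth (R : realType) (n : nat) (U : set 'rV[R]_n)
    (f : 'rV[R]_n -> R) : Prop := forall k, Cdiff U k f.

Definition nonvanishing (R : realType) (n : nat) (U : set 'rV[R]_n)
    (f : 'rV[R]_n -> R) : Prop := forall x, U x -> f x != 0.

Definition vfield (R : realType) (n : nat) : Type := 'rV[R]_n -> 'rV[R]_n.

Definition smooth_vfield (R : realType) (n : nat) (U : set 'rV[R]_n)
    (X : vfield R n) : Prop :=
  forall j : 'I_n, smooth U (fun x => X x 0 j).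

(* The exterior algebra of the dual of R^n: a S is the coefficient of
   dx_{s_1} /\ ... /\ dx_{s_p}, where s_1 < ... < s_p are the elements of S. *)
Definition extalg (R : realType) (n : nat) := {ffun {set 'I_n} -> R^o}.

Definition diff_form (R : realType) (n : nat) : Type := 'rV[R]_n -> extalg R n.

Definition smooth_form (R : realType) (n : nat) (U : set 'rV[R]_n)
    (w : diff_form R n) : Prop :=
  forall S : {set 'I_n}, smooth U (fun x => w x S).

Definition one_form (R : realType) (n : nat) (U : set 'rV[R]_n)
    (w : diff_form R n) : Prop :=
  smooth_form U w /\
  (forall x, U x -> forall S : {set 'I_n}, #|S| != 1%N -> w x S = 0).

(* For disjoint A and B, dx_A /\ dx_B = (-1)^(inversions A B) dx_{A U B}. *)
Definition inversions (n : nat) (A B : {set 'I_n}) : nat :=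
  #|[pred p : 'I_n * 'I_n | [&& p.1 \in A, p.2 \in B & (p.2 < p.1)%N]]|.

Definition ext_wedge (R : realType) (n : nat) (a b : extalg R n) :
    extalg R n :=
  [ffun S : {set 'I_n} => \sum_(A : {set 'I_n} | A \subset S)
     (-1) ^+ inversions A (S :\: A) * a A * b (S :\: A)].

Definition wedge (R : realType) (n : nat) (a b : diff_form R n) :
    diff_form R n :=
  fun x => ext_wedge (a x) (b x).

(* d w = sum_i dx_i /\ (partial_i w), coefficientwise. *)
Definition ext_d (R : realType) (n : nat) (w : diff_form R n) : diff_form R n :=
  fun x => [ffun S : {set 'I_n} => \sum_(i in S)
    (-1) ^+ inversions [set i] (S :\ i)
      * partial i (fun y => w y (S :\ i)) x].

(* dx_{i |: S} = (-1)^(inversions {i} S) dx_i /\ dx_S for i not in S. *)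
Definition interior_prod (R : realType) (n : nat) (X : vfield R n)
    (w : diff_form R n) : diff_form R n :=
  fun x => [ffun S : {set 'I_n} => \sum_(i : 'I_n | i \notin S)
    (-1) ^+ inversions [set i] S * X x 0 i * w x (i |: S)].

(* The coefficient of 1, i.e. the function that a form of degree 0 is. *)
Definition fun_of_form0 (R : realType) (n : nat) (w : diff_form R n) :
    'rV[R]_n -> R := fun x => w x finset.set0.

Definition scalef (R : realType) (n : nat) (V : lmodType R)
    (f : 'rV[R]_n -> R) (v : 'rV[R]_n -> V) : 'rV[R]_n -> V :=
  fun x => f x *: v x.

Definition lie_bracket (R : realType) (n : nat) (X Y : vfield R n) :
    vfield R n :=
  fun x => \row_j ('D_(X x) (fun y => Y y 0 j) x
                   - 'D_(Y x) (fun y => X y 0 j) x).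

Definition independent (R : realType) (n : nat) (V : vectType R)
    (U : set 'rV[R]_n) (B : seq ('rV[R]_n -> V)) : Prop :=
  forall x, U x -> free [seq v x | v <- B].

Definition smspan (R : realType) (n : nat) (V : lmodType R)
    (U : set 'rV[R]_n) (B : seq ('rV[R]_n -> V)) : set ('rV[R]_n -> V) :=
  [set v | exists c : 'I_(size B) -> 'rV[R]_n -> R,
     (forall i, smooth U (c i)) /\
     (forall x, U x -> v x = \sum_(i < size B) c i x *: tnth (in_tuple B) i x)].

Definition is_form_ideal (R : realType) (n : nat) (U : set 'rV[R]_n)
    (I : set (diff_form R n)) : Prop :=
  [/\ I `<=` smooth_form U,
      (forall a b, I a -> (forall x, U x -> a x = b x) -> I b),
      I (fun=> 0),
      (forall a b, I a -> I b -> I (fun x => a x + b x)) &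
      (forall a b, smooth_form U a -> I b ->
         I (wedge a b) /\ I (wedge b a))].

Definition form_ideal (R : realType) (n : nat) (U : set 'rV[R]_n)
    (B : seq (diff_form R n)) : set (diff_form R n) :=
  smallest (is_form_ideal U) [set` B].

Definition differential_ideal (R : realType) (n : nat) (U : set 'rV[R]_n)
    (I : set (diff_form R n)) : Prop :=
  is_form_ideal U I /\ (forall a, I a -> I (ext_d a)).

Definition lie_closed (R : realType) (n : nat) (D : set (vfield R n)) : Prop :=
  forall X Y, D X -> D Y -> D (lie_bracket X Y).

(* B generates a distribution of rank size B, and that is involutive. *)
Definition involutive_distribution (R : realType) (n : nat)
    (U : set 'rV[R]_n) (B : seq (vfield R n)) : Prop :=
  [/\ (forall i : 'I_(size B), smooth_vfield U (tnth (in_tuple B) i)),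
      independent U B & lie_closed (smspan U B)].

Definition annihilator (R : realType) (n : nat) (U : set 'rV[R]_n)
    (D : set (vfield R n)) : set (diff_form R n) :=
  [set w | one_form U w /\
     (forall Z, D Z -> forall x, U x -> interior_prod Z w x = 0)].

Definition Cinf_symmetry (R : realType) (n : nat) (U : set 'rV[R]_n)
    (D : seq (vfield R n)) (X : vfield R n) : Prop :=
  [/\ (size D < n)%N, involutive_distribution U D
    & involutive_distribution U (rcons D X)].

Definition is_symmetry (R : realType) (n : nat) (U : set 'rV[R]_n)
    (D : seq (vfield R n)) (X : vfield R n) : Prop :=
  Cinf_symmetry U D X /\
  (forall i : 'I_(size D),
     smspan U D (lie_bracket X (tnth (in_tuple D) i))).

Definition symmetrizing_factor (R : realType) (n : nat) (U : set 'rV[R]_n)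
    (D : seq (vfield R n)) (X : vfield R n) (f : 'rV[R]_n -> R) : Prop :=
  [/\ smooth U f, nonvanishing U f, Cinf_symmetry U D X
    & is_symmetry U D (scalef f X)].

(* Xfam Z X k = {Z_1..Z_r, X_1..X_k} and Lam w k = {w_{k+1}..w_m}; ordinals
   k : 'I_m count from 0, so tnth X k is X_{k+1} and tnth w k is w_{k+1}. *)
Definition Xfam (R : realType) (n : nat) (Z X : seq (vfield R n)) (k : nat) :
  seq (vfield R n) := Z ++ take k X.

Definition Lam (R : realType) (n : nat) (w : seq (diff_form R n)) (k : nat) :
  seq (diff_form R n) := drop k w.

Definition Cinf_structure (R : realType) (n m : nat) (U : set 'rV[R]_n)
    (Z : seq (vfield R n)) (X : m.-tuple (vfield R n)) : Prop :=
  forall k : 'I_m, Cinf_symmetry U (Xfam Z X k) (tnth X k).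

Definition Cinf_structure_forms (R : realType) (n m : nat) (U : set 'rV[R]_n)
    (Z : seq (vfield R n)) (w : m.-tuple (diff_form R n)) : Prop :=
  [/\ (forall k : 'I_m, one_form U (tnth w k)),
      independent U w,
      smspan U (Lam w 0) = annihilator U (smspan U Z)
    & forall k : nat, (0 < k < m)%N ->
        differential_ideal U (form_ideal U (Lam w k))].

Definition related (R : realType) (n m : nat) (U : set 'rV[R]_n)
    (Z : seq (vfield R n)) (X : m.-tuple (vfield R n))
    (w : m.-tuple (diff_form R n)) : Prop :=
  forall k : nat, (k < m)%N ->
    annihilator U (smspan U (Xfam Z X k)) = smspan U (Lam w k).

Definition integrating_factor (R : realType) (n : nat) (U : set 'rV[R]_n)
    (L : seq (diff_form R n)) (w : diff_form R n) (mu : 'rV[R]_n -> R) : Prop :=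
  [/\ smooth U mu, nonvanishing U mu & form_ideal U L (ext_d (scalef mu w))].

(* Main.v *)
Require Import Defs.
From HB Require Import structures.
From mathcomp Require Import all_boot all_order all_algebra.
From mathcomp Require Import all_classical all_reals all_analysis.
From mathcomp Require Import ring.

Set Implicit Arguments.
Unset Strict Implicit.
Unset Printing Implicit Defensive.

Import Order.TTheory GRing.Theory Num.Theory.
Import numFieldNormedType.Exports.

Local Open Scope classical_set_scope.
Local Open Scope ring_scope.

(* Put theta = mu w_i, where mu = 1 / (f w_i(X_i)), so that theta(f X_i) = 1 while
   theta vanishes on D = S(Xfam Z X i). For b in D, Cartan's formula therefore
   reads d theta(f X_i, b) = - theta([f X_i, b]), and the right-hand side vanishes
   exactly when [f X_i, b] lies in D, since this bracket always lies in the
   involutive S(D, X_i). On the other hand d theta vanishes on pairs from D because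
   D is involutive, and a 2-form lies in the ideal of Lam w i.+1 exactly when it
   vanishes on pairs from Xfam Z X i.+1: the frame Z ++ X has a smooth dual coframe,
   whose members of index at least r + i + 1 lie in S(Lam w i.+1). *)

(** * Smooth functions on an open set *)

Lemma near_eq_differentiable (R : numFieldType) (V W : normedModType R)
    (f g : V -> W) (x : V) :
  (\near x, f x = g x) -> differentiable f x -> differentiable g x.
Proof.
(* The difference [h] vanishes near [x], so it satisfies the little-o condition with differential
   zero; adding it to [f] then gives [g]. *)
move=> fg df; pose h := g - f.
have -> : g = f + h by rewrite /h addrC subrK.
apply: differentiableD => //.
have h0 : \forall y \near x, h y = 0.
  by apply: filterS fg => y fgy; rewrite /h !fctE fgy subrr.
have hx : h x = 0 by exact: nbhs_singleton h0.
have e : h \o shift x = cst (h x) + \0 +o_ 0 id.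
  rewrite hx addr0.
  apply/eqaddoP => eps eps0.
  have : \forall y \near (0 : V), h (shift x y) = 0.
    have := h0; rewrite (near_shift 0 x); apply: filterS => y.
    by rewrite /= subr0.
  apply: filterS => y hy.
  by rewrite !fctE hy subrr normr0 mulr_ge0// ltW.
have d0 : 'd h x = (\0 : {linear V -> W}) :> (V -> W).
  by apply: diff_unique => //; exact: cst_continuous.
by apply/diff_locallyP; rewrite d0; split=> //; exact: cst_continuous.
Qed.

Section smooth_functions.
Context (R : realType) (n : nat) (U : set 'rV[R]_n) (oU : open U).
Implicit Types f g : 'rV[R]_n -> R.

Lemma near_eq_open f g x : (forall y, U y -> f y = g y) -> U x ->
  \forall y \near x, f y = g y.
Proof.
move=> fg Ux; apply: filterS (open_nbhs_nbhs (conj oU Ux)) => y; exact: fg.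
Qed.

Lemma derive_eq_open f g x v : (forall y, U y -> f y = g y) -> U x ->
  'D_v f x = 'D_v g x.
Proof. by move=> fg Ux; exact: near_eq_derive (near_eq_open fg Ux). Qed.

(** Openness of [U] makes continuity and derivatives at points of [U] depend on values in [U] alone.
    Since functions are total maps, every later formula for a derivative is available only on [U]
    and is transported by this lemma. *)
Lemma Cdiff_eq_open k f g : (forall y, U y -> f y = g y) ->
  Cdiff U k f -> Cdiff U k g.
Proof.
elim: k f g => [|k IH] f g fg /=.
  move=> cf x Ux; have := cf x Ux; rewrite /prop_for /continuous_at -fg//.
  by apply: cvg_trans; apply: near_eq_cvg (near_eq_open fg Ux).
move=> [df dp]; split.
  by move=> x Ux; apply: near_eq_differentiable (df x Ux); exact: near_eq_open.
by move=> i; apply: IH (dp i) => y Uy; exact: derive_eq_open.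
Qed.

(** The product and quotient rules keep undifferentiated factors, to which an induction hypothesis
    of order [k] can be applied only after lowering their order by one. *)
Lemma CdiffW k f : Cdiff U k.+1 f -> Cdiff U k f.
Proof.
elim: k f => [|k IH] f [df dp].
  by move=> x Ux; apply: differentiable_continuous; exact: df.
by split=> // i; apply: IH; exact: dp.
Qed.

Lemma Cdiff_cst k (c : R) : Cdiff U k (fun=> c).
Proof.
elim: k c => [|k IH] c /=; first by move=> x _; exact: cst_continuous.
split=> [x _|i]; first exact: differentiable_cst.
by apply: Cdiff_eq_open (IH 0) => y _; rewrite /partial derive_cst.
Qed.

Lemma CdiffD k f g : Cdiff U k f -> Cdiff U k g ->
  Cdiff U k (fun x => f x + g x).
Proof.
elim: k f g => [|k IH] f g /=.
  by move=> cf cg x Ux; apply: continuousD; [exact: cf|exact: cg].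
move=> [df pf] [dg pg]; split=> [x Ux|i].
  by apply: differentiableD; [exact: df|exact: dg].
apply: Cdiff_eq_open (IH _ _ (pf i) (pg i)) => y Uy.
by rewrite /partial -deriveD//; apply: diff_derivable; [exact: df|exact: dg].
Qed.

Lemma CdiffM k f g : Cdiff U k f -> Cdiff U k g ->
  Cdiff U k (fun x => f x * g x).
Proof.
elim: k f g => [|k IH] f g.
  by move=> cf cg x Ux; apply: continuousM; [exact: cf|exact: cg].
move=> hf hg; have [df pf] := hf; have [dg pg] := hg; split=> [x Ux|i].
  by apply: differentiableM; [exact: df|exact: dg].
have h := CdiffD (IH _ _ (CdiffW hf) (pg i)) (IH _ _ (CdiffW hg) (pf i)).
apply: Cdiff_eq_open h => y Uy.
rewrite /partial deriveM//.
- by apply: diff_derivable; exact: df.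
- by apply: diff_derivable; exact: dg.
Qed.

Lemma CdiffV k f : nonvanishing U f -> Cdiff U k f ->
  Cdiff U k (fun x => (f x)^-1).
Proof.
move=> f0; elim: k => [|k IH].
  by move=> cf x Ux; apply: continuousV; [exact: f0|exact: cf].
move=> hf; have [df pf] := hf; split=> [x Ux|i].
  by apply: differentiableV; [exact: df|exact: f0].
have iv := IH (CdiffW hf).
(* The derivative of [1/f] is minus [f^-2] times that of [f], arranged here as a product of
   functions of order [k]. *)
have h := CdiffM (Cdiff_cst k (-1)) (CdiffM (CdiffM iv iv) (pf i)).
apply: Cdiff_eq_open h => y Uy.
rewrite /partial deriveV//; last by apply: diff_derivable; exact: df.
  by rewrite /GRing.scale/= mulN1r mulNr -exprVn expr2.
exact: f0.
Qed.

Lemma smooth_eq f g : (forall y, U y -> f y = g y) -> smooth U f -> smooth U g.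
Proof. by move=> fg hf k; apply: Cdiff_eq_open (hf k). Qed.

Lemma smooth_cst (c : R) : smooth U (fun=> c).
Proof. by move=> k; exact: Cdiff_cst. Qed.

Lemma smoothD f g : smooth U f -> smooth U g -> smooth U (fun x => f x + g x).
Proof. by move=> hf hg k; exact: CdiffD. Qed.

Lemma smoothM f g : smooth U f -> smooth U g -> smooth U (fun x => f x * g x).
Proof. by move=> hf hg k; exact: CdiffM. Qed.

Lemma smoothV f : nonvanishing U f -> smooth U f -> smooth U (fun x => (f x)^-1).
Proof. by move=> f0 hf k; exact: CdiffV. Qed.

Lemma smooth_differentiable f x : smooth U f -> U x -> differentiable f x.
Proof. by move=> /(_ 1)[df _]; exact: df. Qed.

Lemma smooth_partial i f : smooth U f -> smooth U (partial i f).
Proof. by move=> hf k; have [_] := hf k.+1; exact. Qed.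

Lemma smooth_sum I (r : seq I) (P : pred I) (F : I -> 'rV[R]_n -> R) :
  (forall i, P i -> smooth U (F i)) ->
  smooth U (fun x => \sum_(i <- r | P i) F i x).
Proof.
move=> hF; elim: r => [|i r IH].
  by apply: smooth_eq (smooth_cst 0) => y _; rewrite big_nil.
have [Pi|Pi] := boolP (P i).
  by apply: smooth_eq (smoothD (hF _ Pi) IH) => y _; rewrite big_cons Pi.
by apply: smooth_eq IH => y _; rewrite big_cons (negbTE Pi).
Qed.

Lemma smooth_prod I (r : seq I) (P : pred I) (F : I -> 'rV[R]_n -> R) :
  (forall i, P i -> smooth U (F i)) ->
  smooth U (fun x => \prod_(i <- r | P i) F i x).
Proof.
move=> hF; elim: r => [|i r IH].
  by apply: smooth_eq (smooth_cst 1) => y _; rewrite big_nil.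
have [Pi|Pi] := boolP (P i).
  by apply: smooth_eq (smoothM (hF _ Pi) IH) => y _; rewrite big_cons Pi.
by apply: smooth_eq IH => y _; rewrite big_cons (negbTE Pi).
Qed.

Lemma smooth_det m (A : 'rV[R]_n -> 'M[R]_m) :
  (forall i j, smooth U (fun x => A x i j)) -> smooth U (fun x => \det (A x)).
Proof.
move=> hA; apply: smooth_sum => s _; apply: smoothM; first exact: smooth_cst.
by apply: smooth_prod => i _.
Qed.

(** By Cramer's rule each entry is a cofactor divided by the determinant: a polynomial in smooth
    functions over a nonvanishing one. *)
Lemma smooth_invmx m (A : 'rV[R]_n -> 'M[R]_m) :
  (forall x, U x -> A x \in unitmx) ->
  (forall i j, smooth U (fun x => A x i j)) ->
  forall i j, smooth U (fun x => invmx (A x) i j).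
Proof.
move=> uA hA i j.
have hd : smooth U (fun x => (\det (A x))^-1).
  apply: smoothV; last exact: smooth_det.
  by move=> x /uA; rewrite unitmxE unitfE.
have hc : smooth U (fun x => cofactor (A x) j i).
  apply: smoothM; first exact: smooth_cst.
  apply: smooth_det => k l.
  by apply: smooth_eq (hA (lift j k) (lift i l)) => y _; rewrite !mxE.
by apply: smooth_eq (smoothM hd hc) => y Uy; rewrite /invmx uA// !mxE.
Qed.

Lemma derive_partial f x v : smooth U f -> U x ->
  'D_v f x = \sum_i v 0 i * partial i f x.
Proof.
move=> hf Ux; have df := smooth_differentiable hf Ux.
rewrite deriveE// {1}(row_sum_delta v) linear_sum/=; apply: eq_bigr => i _.
by rewrite linearZ/= /partial deriveE.
Qed.

End smooth_functions.

(** * Forms of degree at most two, evaluated on vectors *)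

Section exterior_algebra.
Context (R : realType) (n : nat).
Implicit Types (a b : extalg R n) (u v : 'rV[R]_n) (A B S : {set 'I_n}).

Lemma inversions0l S : inversions finset.set0 S = 0%N.
Proof.
by apply: eq_card0 => -[k l]; rewrite !inE.
Qed.

Lemma inversions0r S : inversions S finset.set0 = 0%N.
Proof.
by apply: eq_card0 => -[k l]; rewrite !inE andbF.
Qed.

Lemma inversions11 (i j : 'I_n) : inversions [set i] [set j] = (j < i)%N.
Proof.
rewrite /inversions; have [ji|ij] := boolP (j < i)%N.
  apply: (@fintype.eq_card1 _ (i, j)) => -[k l]; rewrite !inE xpair_eqE.
  by have [->|//] := eqVneq k i; have [->|//] := eqVneq l j.
apply: eq_card0 => -[k l]; rewrite !inE /=.
by have [->|//] := eqVneq k i; have [->|//] := eqVneq l j; exact: negbTE.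
Qed.

Lemma setD2l (i j : 'I_n) : i != j -> [set i; j]%SET :\ i = [set j]%SET.
Proof. by move=> ij; rewrite setU1K// inE. Qed.

Lemma setD2r (i j : 'I_n) : i != j -> [set i; j]%SET :\ j = [set i]%SET.
Proof. by move=> ij; rewrite finset.setUC setD2l// eq_sym. Qed.

Lemma big_sub_set2 (i j : 'I_n) (F : {set 'I_n} -> R) : i != j ->
  \sum_(A : {set 'I_n} | A \subset [set i; j]%SET) F A =
  F finset.set0 + F [set i]%SET + F [set j]%SET + F [set i; j]%SET.
Proof.
move=> ij.
have s0 (k : 'I_n) : (finset.set0 == [set k]%SET) = false.
  by apply/eqP => /setP/(_ k); rewrite !inE eqxx.
rewrite (bigD1 finset.set0) ?finset.sub0set//=.
rewrite (bigD1 [set i]%SET)/=; last by rewrite finset.sub1set !inE eqxx/= eq_sym s0.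
rewrite (bigD1 [set j]%SET)/=; last first.
  rewrite finset.sub1set !inE eqxx orbT/= eq_sym s0/=.
  by apply/eqP => /setP/(_ j); rewrite !inE eqxx eq_sym (negbTE ij).
rewrite (bigD1 [set i; j]%SET)/=; last first.
  rewrite subxx/= -andbA; apply/and3P; split.
  - by apply/eqP => /setP/(_ j); rewrite !inE eqxx orbT.
  - by apply/eqP => /setP/(_ j); rewrite !inE eqxx orbT eq_sym (negbTE ij).
  - by apply/eqP => /setP/(_ i); rewrite !inE eqxx/= (negbTE ij).
rewrite big1 ?addr0 ?addrA// => A.
case/andP=> /andP[/andP[/andP[As A0] Ai] Aj] Aij; exfalso.
have sub k : k \in A -> (k == i) || (k == j).
  by move=> /(fintype.subsetP As); rewrite !inE.
(* Whether [i] and [j] belong to [A] determines [A], and each of the four cases is a subset already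
   split off. *)
have [iA|iA] := boolP (i \in A); have [jA|jA] := boolP (j \in A).
- case/eqP: Aij; apply/eqP; rewrite finset.eqEsubset As/=.
  by apply/fintype.subsetP => k; rewrite !inE => /orP[]/eqP->.
- case/eqP: Ai; apply/setP => k; rewrite !inE; apply/idP/eqP => [kA|->//].
  by case/orP: (sub _ kA) => /eqP// kj; rewrite -kj kA in jA.
- case/eqP: Aj; apply/setP => k; rewrite !inE; apply/idP/eqP => [kA|->//].
  by case/orP: (sub _ kA) => /eqP// kj; rewrite -kj kA in iA.
- case/eqP: A0; apply/setP => k; rewrite !inE; apply/negbTE/negP => kA.
  by case/orP: (sub _ kA) => /eqP kj; rewrite -kj kA in iA jA.
Qed.

(* The values at v of the degree 1 part of a, and at (u, v) of its degree 2 part,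
   coef2 a i j being the latter at the i-th and j-th basis vectors. *)
Definition ev1 a v : R := \sum_i v 0 i * a [set i]%SET.

Definition coef2 a (i j : 'I_n) : R :=
  if i == j then 0 else (-1) ^+ (j < i)%N * a [set i; j]%SET.

Definition ev2 a u v : R := \sum_i \sum_j coef2 a i j * u 0 i * v 0 j.

Lemma sign_swap (i j : 'I_n) : i != j ->
  (-1) ^+ (j < i)%N = - (-1) ^+ (i < j)%N :> R.
Proof.
move=> ij; case: (ltngtP i j) => [||/ord_inj] h.
- by rewrite expr0 expr1 opprK.
- by rewrite expr0 expr1.
- by rewrite h eqxx in ij.
Qed.

Lemma sign_sq (c : bool) : (-1) ^+ c * (-1) ^+ c = 1 :> R.
Proof. by case: c; rewrite ?expr0 ?expr1 ?mulr1 ?mulrNN ?mulr1. Qed.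

Lemma coef2_eq a i j : i != j ->
  a [set i; j]%SET = (-1) ^+ (j < i)%N * coef2 a i j.
Proof. by move=> ij; rewrite /coef2 (negbTE ij) mulrA sign_sq mul1r. Qed.

Lemma coef2C a i j : coef2 a j i = - coef2 a i j.
Proof.
rewrite /coef2 eq_sym; have [_|ij] := eqVneq i j; first by rewrite oppr0.
by rewrite [[set j; i]%SET]finset.setUC (sign_swap ij) mulNr opprK.
Qed.

Lemma ext_wedge0 a b :
  ext_wedge a b finset.set0 = a finset.set0 * b finset.set0.
Proof.
rewrite ffunE (bigD1 finset.set0) ?subxx//= big1 ?addr0.
  by rewrite inversions0l expr0 mul1r finset.set0D.
by move=> A /andP[]; rewrite finset.subset0 => ->.
Qed.

Lemma ext_wedge1 a b i : ext_wedge a b [set i]%SET =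
  a finset.set0 * b [set i]%SET + a [set i]%SET * b finset.set0.
Proof.
have s0 : [set i]%SET != finset.set0 by apply/finset.set0Pn; exists i; rewrite inE.
rewrite ffunE (bigD1 finset.set0) ?finset.sub0set//=.
rewrite (bigD1 [set i]%SET) ?subxx ?s0//= big1 ?addr0.
  rewrite inversions0l finset.setD0 finset.setDv inversions0r expr0 mul1r.
  by rewrite mul1r.
by move=> A /andP[/andP[]]; rewrite subset1 => /orP[]->.
Qed.

(** The four terms are the four ways of distributing [i] and [j] between the two factors; for
    [i = j] the middle two cancel and the outer two are zero. *)
Lemma coef2_wedge a b i j : coef2 (ext_wedge a b) i j =
  a finset.set0 * coef2 b i j + a [set i]%SET * b [set j]%SET
  - a [set j]%SET * b [set i]%SET + coef2 a i j * b finset.set0.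
Proof.
rewrite /coef2; have [->|ij] := eqVneq i j.
  by rewrite mulr0 mul0r add0r addr0 subrr.
rewrite ffunE big_sub_set2// finset.setD0 setD2l// setD2r// finset.setDv.
rewrite inversions0l inversions0r !inversions11 !mulrDr !expr0 !mul1r !mulrA.
congr (_ + _ + _ + _).
- by rewrite [_ * a _]mulrC.
- by rewrite sign_sq mul1r.
- by rewrite (sign_swap ij) mulNr sign_sq mulN1r mulNr.
Qed.

Lemma ev1_wedge a b v : ev1 (ext_wedge a b) v =
  a finset.set0 * ev1 b v + ev1 a v * b finset.set0.
Proof.
rewrite /ev1 mulr_sumr mulr_suml -big_split/=; apply: eq_bigr => i _.
by rewrite ext_wedge1; ring.
Qed.

Lemma ev2_wedge a b u v : ev2 (ext_wedge a b) u v =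
  a finset.set0 * ev2 b u v + ev1 a u * ev1 b v - ev1 a v * ev1 b u
  + ev2 a u v * b finset.set0.
Proof.
have prodE (c d : extalg R n) (s t : 'rV[R]_n) : ev1 c s * ev1 d t =
    \sum_i \sum_j (s 0 i * c [set i]%SET) * (t 0 j * d [set j]%SET).
  by rewrite /ev1 mulr_suml; apply: eq_bigr => i _; rewrite mulr_sumr.
rewrite [ev1 a v * _]mulrC !prodE /ev2 mulr_sumr mulr_suml.
rewrite -sumrN -!big_split/=; apply: eq_bigr => i _.
rewrite mulr_sumr mulr_suml -sumrN -!big_split/=; apply: eq_bigr => j _.
by rewrite coef2_wedge; ring.
Qed.

Lemma ev1D a u v : ev1 a (u + v) = ev1 a u + ev1 a v.
Proof.
by rewrite /ev1 -big_split; apply: eq_bigr => i _; rewrite mxE mulrDl.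
Qed.

Lemma ev1Z a c v : ev1 a (c *: v) = c * ev1 a v.
Proof.
by rewrite /ev1 mulr_sumr; apply: eq_bigr => i _; rewrite mxE mulrA.
Qed.

Lemma ev1Zl a c v : ev1 (c *: a) v = c * ev1 a v.
Proof.
by rewrite /ev1 mulr_sumr; apply: eq_bigr => i _; rewrite ffunE mulrCA.
Qed.

Lemma ev1_sum a I (s : seq I) (P : pred I) (F : I -> 'rV[R]_n) :
  ev1 a (\sum_(i <- s | P i) F i) = \sum_(i <- s | P i) ev1 a (F i).
Proof.
apply: (big_morph (ev1 a)); first exact: ev1D.
by rewrite /ev1 big1// => i _; rewrite mxE mul0r.
Qed.

Lemma ev1_suml v I (s : seq I) (P : pred I) (F : I -> extalg R n) :
  ev1 (\sum_(i <- s | P i) F i) v = \sum_(i <- s | P i) ev1 (F i) v.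
Proof.
apply: (big_morph (ev1^~ v)).
  by move=> a b; rewrite /ev1 -big_split; apply: eq_bigr => i _;
    rewrite ffunE mulrDr.
by rewrite /ev1 big1// => i _; rewrite ffunE mulr0.
Qed.

Lemma ev2C a u v : ev2 a v u = - ev2 a u v.
Proof.
rewrite /ev2 exchange_big -sumrN; apply: eq_bigr => i _.
by rewrite -sumrN; apply: eq_bigr => j _; rewrite (coef2C a i j); ring.
Qed.

Lemma ev2Zl a c u v : ev2 a (c *: u) v = c * ev2 a u v.
Proof.
rewrite /ev2 mulr_sumr; apply: eq_bigr => i _.
by rewrite mulr_sumr; apply: eq_bigr => j _; rewrite mxE; ring.
Qed.

Lemma ev2Zr a c u v : ev2 a u (c *: v) = c * ev2 a u v.
Proof. by rewrite ev2C ev2Zl ev2C mulrN opprK. Qed.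

Lemma coef2D a b i j : coef2 (a + b) i j = coef2 a i j + coef2 b i j.
Proof.
by rewrite /coef2; case: eqP; rewrite ?addr0// ffunE mulrDr.
Qed.

Lemma ev2Dl a b u v : ev2 (a + b) u v = ev2 a u v + ev2 b u v.
Proof.
rewrite /ev2 -big_split/=; apply: eq_bigr => i _; rewrite -big_split/=.
by apply: eq_bigr => j _; rewrite coef2D; ring.
Qed.

Lemma extalg2P a b :
  (forall S, #|S| != 2%N -> a S = 0) -> (forall S, #|S| != 2%N -> b S = 0) ->
  coef2 a =2 coef2 b -> a = b.
Proof.
move=> a2 b2 ab; apply/ffunP => S; have [/eqP/cards2P|S2] := eqVneq #|S| 2%N.
  by move=> [i [j [ij ->]]]; rewrite !coef2_eq// ab.
by rewrite a2// b2.
Qed.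

Lemma ext_wedge11 a b S :
  (forall S, #|S| != 1%N -> a S = 0) -> (forall S, #|S| != 1%N -> b S = 0) ->
  #|S| != 2%N -> ext_wedge a b S = 0.
Proof.
move=> a1 b1 S2; rewrite ffunE big1// => A AS.
have [A1|/a1->] := eqVneq #|A| 1%N; last by rewrite mulr0 mul0r.
rewrite b1 ?mulr0//; apply: contra S2 => /eqP B1.
by rewrite -(cardsID A) (finset.setIidPr AS) A1 B1.
Qed.

End exterior_algebra.

(** * Exterior derivative, contraction and Cartan's formula *)

Section differential_forms.
Context (R : realType) (n : nat) (U : set 'rV[R]_n) (oU : open U).
Implicit Types (a b w : diff_form R n) (u v : vfield R n).

Lemma coef2_ext_d w x i j : coef2 (ext_d w x) i j =
  partial i (fun y => w y [set j]%SET) x - partial j (fun y => w y [set i]%SET) x.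
Proof.
rewrite /coef2; have [->|ij] := eqVneq i j; first by rewrite subrr.
rewrite ffunE big_setU1 ?inE//= big_set1 setD2l// setD2r// !inversions11.
by rewrite mulrDr !mulrA sign_sq mul1r (sign_swap R ij) mulNr sign_sq mulN1r.
Qed.

(** Outside degree 1 the coefficients of [w] vanish on the whole open set [U], so their partial
    derivatives vanish there too. *)
Lemma ext_d_support w x (S : {set 'I_n}) : one_form U w -> U x ->
  #|S| != 2%N -> ext_d w x S = 0.
Proof.
move=> [_ w1] Ux S2; rewrite ffunE big1// => i iS.
rewrite /partial (derive_eq_open oU (g := fun=> 0) _ _ Ux).
  by rewrite derive_cst mulr0.
move=> y Uy; apply: w1 => //; apply: contra S2.
by rewrite (cardsD1 i S) iS => /eqP->.
Qed.

Lemma smooth_ext_d w : smooth_form U w -> smooth_form U (ext_d w).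
Proof.
move=> hw S; pose F (i : 'I_n) x : R := (-1) ^+ inversions [set i] (S :\ i)
  * partial i (fun y => w y (S :\ i)) x.
apply: (smooth_eq oU (f := fun x => \sum_(i in S) F i x)).
  by move=> y _; rewrite ffunE.
apply: (smooth_sum oU) => i _; apply: (smoothM oU).
  exact: (smooth_cst oU).
exact: smooth_partial (hw _).
Qed.

Lemma smooth_wedge a b : smooth_form U a -> smooth_form U b ->
  smooth_form U (wedge a b).
Proof.
move=> ha hb S; pose F (A : {set 'I_n}) x : R :=
  (-1) ^+ inversions A (S :\: A) * a x A * b x (S :\: A).
apply: (smooth_eq oU (f := fun x => \sum_(A : {set 'I_n} | A \subset S) F A x)).
  by move=> y _; rewrite ffunE.
apply: (smooth_sum oU) => A _; apply: (smoothM oU); last exact: hb.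
by apply: (smoothM oU); [exact: (smooth_cst oU)|exact: ha].
Qed.

Lemma smooth_ev1 w u : smooth_form U w -> smooth_vfield U u ->
  smooth U (fun x => ev1 (w x) (u x)).
Proof.
by move=> hw hu; apply: (smooth_sum oU) => i _; apply: (smoothM oU).
Qed.

Lemma smooth_coef2 w i j : smooth_form U w ->
  smooth U (fun x => coef2 (w x) i j).
Proof.
move=> hw; rewrite /coef2; case: eqP => _; first exact: (smooth_cst oU).
by apply: (smoothM oU); first exact: (smooth_cst oU).
Qed.

Lemma smooth_ev2 w u v : smooth_form U w -> smooth_vfield U u ->
  smooth_vfield U v -> smooth U (fun x => ev2 (w x) (u x) (v x)).
Proof.
move=> hw hu hv; do 2!apply: (smooth_sum oU) => ? _.
by do 2!apply: (smoothM oU) => //; exact: smooth_coef2.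
Qed.

Lemma smooth_scale_form f w : smooth U f -> smooth_form U w ->
  smooth_form U (scalef f w).
Proof.
move=> hf hw S; apply: (smooth_eq oU (f := fun x => f x * w x S)).
  by move=> y _; rewrite ffunE.
exact: (smoothM oU).
Qed.

Lemma one_form_scale f w : smooth U f -> one_form U w ->
  one_form U (scalef f w).
Proof.
move=> hf [sw w1]; split; first exact: smooth_scale_form.
by move=> x Ux S S1; rewrite ffunE w1// scaler0.
Qed.

Lemma smooth_scale_vfield f u : smooth U f -> smooth_vfield U u ->
  smooth_vfield U (scalef f u).
Proof.
move=> hf hu j; apply: (smooth_eq oU (f := fun x => f x * u x 0 j)).
  by move=> y _; rewrite /scalef mxE.
exact: (smoothM oU).
Qed.

Lemma interior_prod0 u w x :
  interior_prod u w x finset.set0 = ev1 (w x) (u x).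
Proof.
rewrite ffunE /ev1; apply: eq_big => [i|i _]; first by rewrite inE.
by rewrite inversions0r expr0 mul1r finset.setU0.
Qed.

Lemma interior_prod_one_form u w x : one_form U w -> U x ->
  ev1 (w x) (u x) = 0 -> interior_prod u w x = 0.
Proof.
move=> [_ w1] Ux wu0; apply/ffunP => S; rewrite [RHS]ffunE.
have [->|/finset.set0Pn[j jS]] := eqVneq S finset.set0.
  by rewrite interior_prod0.
(* For [S] containing [j] and not [i], the set [i |: S] has at least two elements, where a 1-form
   has no coefficient. *)
rewrite ffunE big1// => i iS; rewrite w1 ?mulr0// cardsU1 iS (cardsD1 j) jS.
by [].
Qed.

Lemma derive_ev1 w u x c : smooth_form U w -> smooth_vfield U u -> U x ->
  'D_c (fun y => ev1 (w y) (u y)) x =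
  \sum_j (u x 0 j * 'D_c (fun y => w y [set j]%SET) x
          + w x [set j]%SET * 'D_c (fun y => u y 0 j) x).
Proof.
move=> hw hu Ux.
have du (f : 'rV[R]_n -> R) : smooth U f -> derivable f x c.
  by move=> hf; apply: diff_derivable; exact: smooth_differentiable hf Ux.
have -> : (fun y => ev1 (w y) (u y)) =
    \sum_j ((fun y => u y 0 j : R) * (fun y => w y [set j]%SET : R)).
  by apply/funext => y; rewrite fct_sumE.
rewrite derive_sum; last first.
  by move=> j; apply: derivableM; apply: du; [exact: hu|exact: hw].
apply: eq_bigr => j _; rewrite deriveM//; apply: du; [exact: hu|exact: hw].
Qed.

(** Leibniz' rule for the two pairings produces derivatives of the components of [u] and [v], which
    add up to the pairing of [w] with the bracket and cancel; what remains are derivatives of the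
    coefficients of [w], that is [ext_d w]. *)
Lemma cartan_formula w u v x : smooth_form U w ->
  smooth_vfield U u -> smooth_vfield U v -> U x ->
  ev2 (ext_d w x) (u x) (v x) =
  'D_(u x) (fun y => ev1 (w y) (v y)) x - 'D_(v x) (fun y => ev1 (w y) (u y)) x
  - ev1 (w x) (lie_bracket u v x).
Proof.
move=> hw hu hv Ux; rewrite !derive_ev1// /ev1 -!sumrB.
pose P i j := partial i (fun y => w y [set j]%SET) x.
(* The contribution of the derivatives of [w] alone, grouped by the component [i] of [w] so that the
   bracket terms can be cancelled one component at a time. *)
transitivity (\sum_i (\sum_j P j i * u x 0 j * v x 0 i)
              - \sum_i (\sum_j P j i * v x 0 j * u x 0 i)).
  rewrite [X in X - _]exchange_big -sumrB; apply: eq_bigr => i _.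
  rewrite -sumrB; apply: eq_bigr => j _; rewrite coef2_ext_d /P; ring.
rewrite -sumrB; apply: eq_bigr => i _; rewrite mxE.
rewrite !(derive_partial (f := fun y => w y [set i]%SET) _ (hw _) Ux).
have S (c d : 'rV[R]_n) : \sum_j P j i * c 0 j * d 0 i =
    d 0 i * \sum_j c 0 j * P j i.
  by rewrite mulr_sumr; apply: eq_bigr => j _; ring.
by rewrite !S /P; ring.
Qed.

End differential_forms.

(** * The ideal generated by a family of 1-forms *)

Section form_ideals.
Context (R : realType) (n : nat) (U : set 'rV[R]_n) (oU : open U).
Context (L : seq (diff_form R n)).
Implicit Types (a b w : diff_form R n) (u v : vfield R n).

(** [form_ideal] is the intersection of all ideals containing [L], so this closure property, like
    the next ones, is inherited from each such ideal [I]. *)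
Lemma form_ideal_eq a b : (forall x, U x -> a x = b x) ->
  form_ideal U L a -> form_ideal U L b.
Proof.
by move=> ab La I [hI LI]; have [_ h _ _ _] := hI; apply: h ab; exact: La.
Qed.

Lemma form_ideal0 : form_ideal U L (fun=> 0).
Proof. by move=> I [[]]. Qed.

Lemma form_idealD a b : form_ideal U L a -> form_ideal U L b ->
  form_ideal U L (fun x => a x + b x).
Proof.
move=> La Lb I [hI LI]; have [_ _ _ h _] := hI.
by apply: h; [exact: La|exact: Lb].
Qed.

Lemma form_ideal_wedgel a b : smooth_form U a -> form_ideal U L b ->
  form_ideal U L (wedge a b).
Proof.
move=> sa Lb I [hI LI]; have [_ _ _ _ h] := hI.
by have [] := h _ _ sa (Lb _ (conj hI LI)).
Qed.

Lemma form_ideal_wedger a b : smooth_form U a -> form_ideal U L b ->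
  form_ideal U L (wedge b a).
Proof.
move=> sa Lb I [hI LI]; have [_ _ _ _ h] := hI.
by have [] := h _ _ sa (Lb _ (conj hI LI)).
Qed.

Lemma form_ideal_scale f a : smooth U f -> form_ideal U L a ->
  form_ideal U L (scalef f a).
Proof.
(* [c] is [f] seen as a form of degree 0, which turns scaling into a wedge product. *)
move=> sf La; pose c : diff_form R n := fun x =>
  [ffun S : {set 'I_n} => if S == finset.set0 then f x else 0 : R].
have sc : smooth_form U c.
  move=> S; have [S0|S0] := boolP (S == finset.set0).
    by apply: (smooth_eq oU) sf => y _; rewrite ffunE S0.
  by apply: (smooth_eq oU) (smooth_cst oU 0) => y _; rewrite ffunE (negbTE S0).
apply: form_ideal_eq (form_ideal_wedgel sc La) => x _; apply/ffunP => S.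
rewrite !ffunE (bigD1 finset.set0) ?finset.sub0set//= big1 ?addr0.
  by rewrite inversions0l expr0 mul1r ffunE eqxx finset.setD0.
by move=> A /andP[_ A0]; rewrite ffunE (negbTE A0) mulr0 mul0r.
Qed.

Lemma form_ideal_sum I (s : seq I) (P : pred I) (F : I -> diff_form R n) :
  (forall i, P i -> form_ideal U L (F i)) ->
  form_ideal U L (fun x => \sum_(i <- s | P i) F i x).
Proof.
move=> hF; elim: s => [|i s IH].
  by apply: form_ideal_eq form_ideal0 => x _; rewrite big_nil.
have [Pi|Pi] := boolP (P i).
  apply: form_ideal_eq (form_idealD (hF i Pi) IH) => x _.
  by rewrite big_cons Pi.
by apply: form_ideal_eq IH => x _; rewrite big_cons (negbTE Pi).
Qed.

Lemma smspan_form_ideal : smspan U L `<=` form_ideal U L.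
Proof.
move=> w [c [sc wE]].
apply: (form_ideal_eq (fun x Ux => esym (wE x Ux))).
apply: form_ideal_sum => i _; apply: form_ideal_scale => //.
by apply: sub_gen_smallest; exact: mem_tnth.
Qed.

(* The forms without constant term whose parts of degree 1 and 2 vanish on u, v
   and (u, v) form an ideal. *)
Lemma form_ideal_vanishing u v a :
  (forall w, w \in L -> one_form U w) ->
  (forall w, w \in L -> forall x, U x ->
     ev1 (w x) (u x) = 0 /\ ev1 (w x) (v x) = 0) ->
  form_ideal U L a -> forall x, U x -> ev2 (a x) (u x) (v x) = 0.
Proof.
move=> L1 Luv La.
pose J : set (diff_form R n) := [set b | smooth_form U b /\
  forall x, U x -> [/\ b x finset.set0 = 0, ev1 (b x) (u x) = 0,
    ev1 (b x) (v x) = 0 & ev2 (b x) (u x) (v x) = 0]].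
suff [_ h] : J a by move=> x /h[].
apply: La; split; last first.
  move=> w /= wL; have [sw w1] := L1 _ wL; split=> // x Ux.
  have [wu wv] := Luv _ wL _ Ux; split=> //; first by rewrite w1// cards0.
  rewrite /ev2 big1// => i _; rewrite big1// => j _; rewrite /coef2.
  case: eqVneq => [|ij]; first by rewrite !mul0r.
  by rewrite w1 ?mulr0 ?mul0r// cards2 ij.
split.
- by move=> b [].
- move=> b c [sb hb] bc; split=> [S|x Ux]; last by rewrite -bc//; exact: hb.
  by apply: (smooth_eq oU) (sb S) => x Ux; rewrite bc.
- split=> [S|x _].
    by apply: (smooth_eq oU) (smooth_cst oU 0) => x _; rewrite ffunE.
  rewrite ffunE /ev1 /ev2; split=> //.
  + by rewrite big1// => i _; rewrite ffunE mulr0.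
  + by rewrite big1// => i _; rewrite ffunE mulr0.
  + rewrite big1// => i _; rewrite big1// => j _.
    by rewrite /coef2 ffunE mulr0 if_same !mul0r.
- move=> b c [sb hb] [sc hc]; split=> [S|x Ux].
    by apply: (smooth_eq oU) (smoothD oU (sb S) (sc S)) => x _; rewrite ffunE.
  have [b0 bu bv buv] := hb x Ux; have [c0 cu cv cuv] := hc x Ux.
  have ev1Dl (y : 'rV[R]_n) : ev1 (b x + c x) y = ev1 (b x) y + ev1 (c x) y.
    by rewrite /ev1 -big_split; apply: eq_bigr => i _; rewrite ffunE mulrDr.
  by rewrite ffunE !ev1Dl ev2Dl b0 c0 bu cu bv cv buv cuv !addr0.
- move=> b c sb [sc hc].
  have [] : smooth_form U (wedge b c) /\ smooth_form U (wedge c b).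
    by split; exact: (smooth_wedge oU).
  split; split=> // x Ux; have [c0 cu cv cuv] := hc x Ux;
    by rewrite /wedge ext_wedge0 !ev1_wedge ev2_wedge c0 cu cv cuv
      ?(mulr0, mul0r, addr0, subr0).
Qed.

End form_ideals.

(** * Frames and dual coframes *)

Section frames.
Context (R : realType) (n : nat).
Implicit Types (a : extalg R n) (u v : 'rV[R]_n).

Lemma ev2_suml a v I (s : seq I) (P : pred I) (F : I -> 'rV[R]_n) :
  ev2 a (\sum_(i <- s | P i) F i) v = \sum_(i <- s | P i) ev2 a (F i) v.
Proof.
apply: (big_morph (fun u => ev2 a u v)) => [u1 u2|].
  rewrite /ev2 -big_split/=; apply: eq_bigr => i _; rewrite -big_split/=.
  by apply: eq_bigr => j _; rewrite mxE; ring.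
by rewrite /ev2 big1// => i _; rewrite big1// => j _; rewrite mxE mulr0 mul0r.
Qed.

Lemma ev2_sumr a u I (s : seq I) (P : pred I) (F : I -> 'rV[R]_n) :
  ev2 a u (\sum_(i <- s | P i) F i) = \sum_(i <- s | P i) ev2 a u (F i).
Proof.
by rewrite ev2C ev2_suml -sumrN; apply: eq_bigr => i _; rewrite ev2C opprK.
Qed.

Lemma ev2_diag a u : ev2 a u u = 0.
Proof.
by have /eqP := ev2C a u u; rewrite -addr_eq0 -mulr2n mulrn_eq0 => /eqP.
Qed.

Lemma ev2_delta a i j : ev2 a (delta_mx 0 i) (delta_mx 0 j) = coef2 a i j.
Proof.
rewrite /ev2 (bigD1 i)//= (bigD1 j)//= !mxE !eqxx !mulr1 !big1 ?addr0//.
  move=> k /negbTE ki; rewrite big1// => l _.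
  by rewrite mxE ki andbF mulr0 mul0r.
by move=> l /negbTE lj; rewrite !mxE lj andbF mulr0.
Qed.

(** The last hypothesis expands each basis vector in the [e p], so bilinearity recovers [a] from its
    values on pairs of the [e p]. The factor one half is there because the sum runs over ordered
    pairs. *)
Lemma ext_wedge_coframe (e : 'I_n -> 'rV[R]_n) (eta : 'I_n -> extalg R n) a :
  (forall S : {set 'I_n}, #|S| != 2%N -> a S = 0) ->
  (forall p (S : {set 'I_n}), #|S| != 1%N -> eta p S = 0) ->
  (forall i, \sum_p eta p [set i]%SET *: e p = delta_mx 0 i) ->
  a = \sum_p \sum_q (2^-1 * ev2 a (e p) (e q)) *: ext_wedge (eta p) (eta q).
Proof.
move=> a2 eta1 etae; apply: extalg2P => // [S S2|i j].
  rewrite sum_ffunE big1// => p _; rewrite sum_ffunE big1// => q _.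
  by rewrite ffunE ext_wedge11 ?scaler0//; exact: eta1.
have coef2_sum (F : 'I_n -> extalg R n) :
    coef2 (\sum_p F p) i j = \sum_p coef2 (F p) i j.
  apply: (big_morph (fun b => coef2 b i j)) => [b c|]; first exact: coef2D.
  by rewrite /coef2 ffunE mulr0 if_same.
have coef2Z c (b : extalg R n) : coef2 (c *: b) i j = c * coef2 b i j.
  by rewrite /coef2; case: eqP; rewrite ?mulr0// ffunE mulrCA.
have eta0 p : eta p finset.set0 = 0 by rewrite eta1// cards0.
(* [T k l] is the value of [a] on the basis vectors [k] and [l] after expanding both in the
   [e p]. *)
pose T k l := \sum_p \sum_q
  eta p [set k]%SET * (eta q [set l]%SET * ev2 a (e p) (e q)).
have TE k l : T k l = coef2 a k l.
  rewrite -ev2_delta -!etae ev2_suml; apply: eq_bigr => p _.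
  by rewrite ev2_sumr; apply: eq_bigr => q _; rewrite ev2Zl ev2Zr.
(* The wedge of two 1-forms antisymmetrizes its coefficients, hence the difference; antisymmetry of
   [coef2 a] makes it twice [coef2 a i j]. *)
transitivity (2^-1 * (T i j - T j i)).
  by rewrite !TE [coef2 a j i]coef2C; field.
rewrite coef2_sum -sumrB mulr_sumr; apply: eq_bigr => p _.
rewrite coef2_sum -sumrB mulr_sumr; apply: eq_bigr => q _.
by rewrite coef2Z coef2_wedge !eta0; ring.
Qed.

(** A row of the kernel matrix is a linear relation between the vectors of [s], which freeness
    forces to be trivial. *)
Lemma free_unitmx (s : n.-tuple 'rV[R]_n) :
  free s -> (\matrix_(i < n) tnth s i) \in unitmx.
Proof.
move=> /freeP fs; rewrite -row_free_unit -kermx_eq0; apply/eqP/row_matrixP.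
move=> k; rewrite row0; set v := row k _.
have : v *m (\matrix_i tnth s i) = 0.
  by apply: sub_kermxP; exact: row_sub.
rewrite mulmx_sum_row => v0; apply/rowP => i; rewrite [RHS]mxE.
apply: (fs (fun l => v 0 l)).
rewrite -[RHS]v0; apply: eq_bigr => l _.
by rewrite rowK (tnth_nth 0).
Qed.

(** The coframe consists of the columns of the inverse of the frame matrix [M]: the product of [M]
    with its inverse gives duality, and the product in the other order decomposes the basis
    vectors. *)
Lemma smooth_coframe (U : set 'rV[R]_n) (e : 'I_n -> vfield R n) : open U ->
  (forall p, smooth_vfield U (e p)) ->
  (forall x, U x -> (\matrix_p e p x) \in unitmx) ->
  exists eta : 'I_n -> diff_form R n, [/\ forall p, one_form U (eta p),
    forall p q x, U x -> ev1 (eta p x) (e q x) = (q == p)%:R &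
    forall i x, U x -> \sum_p eta p x [set i]%SET *: e p x = delta_mx 0 i].
Proof.
move=> oU se ue; pose M x := \matrix_p e p x.
have sV i p : smooth U (fun x => invmx (M x) i p).
  apply: (smooth_invmx oU) => // k l.
  by apply: (smooth_eq oU) (se k l) => x _; rewrite !mxE.
(* At most one [i] satisfies [S == [set i]], so the sum selects one entry on a singleton and is zero
   on every other set. *)
pose eta p : diff_form R n := fun x =>
  [ffun S : {set 'I_n} => \sum_(i | S == [set i]%SET) invmx (M x) i p : R].
have etaE p x i : eta p x [set i]%SET = invmx (M x) i p.
  rewrite ffunE (bigD1 i)//= big1 ?addr0// => j /andP[/eqP ij].
  by have /setP/(_ i) := ij; rewrite !inE eqxx => /esym/eqP->; rewrite eqxx.
exists eta; split.
- move=> p; split.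
    move=> S; apply: (smooth_eq oU (f := fun x =>
        \sum_(i | S == [set i]%SET) invmx (M x) i p)).
      by move=> x _; rewrite ffunE.
    by apply: (smooth_sum oU) => i _.
  move=> x _ S S1; rewrite ffunE big1// => i /eqP Si.
  by rewrite Si cards1 in S1.
- move=> p q x Ux; rewrite /ev1.
  have /matrixP/(_ q p) := mulmxV (ue x Ux).
  rewrite !mxE => <-; apply: eq_bigr => i _.
  by rewrite etaE !mxE.
- move=> i x Ux; apply/rowP => k.
  have /matrixP/(_ i k) := mulVmx (ue x Ux).
  rewrite summxE !mxE eqxx eq_sym => <-; apply: eq_bigr => p _.
  by rewrite mxE etaE !mxE.
Qed.

End frames.

(** * Spans over the smooth functions, annihilators and symmetries *)

Section smooth_spans.
Context (R : realType) (n : nat) (U : set 'rV[R]_n) (oU : open U).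

(** Coefficients indexed by [nat] are free of the type ['I_(size B)], which changes when [B] is
    extended by [rcons]. *)
Lemma smspan_nthP (V : lmodType R) (B : seq ('rV[R]_n -> V)) v :
  smspan U B v <-> exists c : nat -> 'rV[R]_n -> R,
    (forall i, smooth U (c i)) /\
    (forall x, U x -> v x = \sum_(i < size B) c i x *: nth (fun=> 0) B i x).
Proof.
split=> [[c [sc vE]]|[c [sc vE]]].
  (* Beyond the size of [B] the coefficient is zero, which keeps all of them smooth. *)
  exists (fun i => if insub i is Some j then c j else fun=> 0); split.
    by move=> i; case: insubP => // _; exact: (smooth_cst oU).
  move=> x Ux; rewrite vE//; apply: eq_bigr => i _.
  by rewrite valK (tnth_nth (fun=> 0)).
exists (fun i => c i); split=> // x Ux; rewrite vE//; apply: eq_bigr => i _.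
by rewrite (tnth_nth (fun=> 0)).
Qed.

Lemma smspan_eq (V : lmodType R) (B : seq ('rV[R]_n -> V)) u v :
  (forall x, U x -> u x = v x) -> smspan U B u -> smspan U B v.
Proof.
by move=> uv [c [sc uE]]; exists c; split=> // x Ux; rewrite -uv// uE.
Qed.

Lemma smspan_rconsP (V : lmodType R) (B : seq ('rV[R]_n -> V)) b v :
  smspan U (rcons B b) v <-> exists g u, [/\ smooth U g, smspan U B u &
    forall x, U x -> v x = u x + g x *: b x].
Proof.
split=> [/smspan_nthP[c [sc vE]]|[g [u [sg /smspan_nthP[c [sc uE]] vE]]]].
  exists (c (size B)), (fun x => \sum_(i < size B) c i x *: nth (fun=> 0) B i x).
  split=> //; first by apply/smspan_nthP; exists c.
  move=> x Ux; rewrite vE// size_rcons big_ord_recr/= nth_rcons ltnn eqxx.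
  by congr (_ + _); apply: eq_bigr => i _; rewrite nth_rcons ltn_ord.
apply/smspan_nthP; exists (fun i => if (i < size B)%N then c i else g); split.
  by move=> i; case: ifP.
move=> x Ux; rewrite vE// uE// size_rcons big_ord_recr/= nth_rcons ltnn eqxx.
by congr (_ + _); apply: eq_bigr => i _; rewrite nth_rcons ltn_ord.
Qed.

Lemma smspan_mem (V : lmodType R) (B : seq ('rV[R]_n -> V)) i :
  smspan U B (tnth (in_tuple B) i).
Proof.
exists (fun j => fun=> (j == i)%:R); split=> [j|x _].
  exact: (smooth_cst oU).
rewrite (bigD1 i)//= eqxx scale1r big1 ?addr0// => j /negbTE->.
by rewrite scale0r.
Qed.

(** [f] is a unit among the smooth functions on [U], so the coefficient of the last generator can be
    multiplied or divided by it. *)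
Lemma smspan_rcons_scale (V : lmodType R) (B : seq ('rV[R]_n -> V)) b f :
  smooth U f -> nonvanishing U f ->
  smspan U (rcons B (scalef f b)) = smspan U (rcons B b).
Proof.
move=> sf f0; apply/seteqP; split=> v /smspan_rconsP[g [u [sg su vE]]];
    apply/smspan_rconsP.
  exists (fun x => g x * f x), u; split=> //; first exact: (smoothM oU).
  by move=> x Ux; rewrite vE// /scalef scalerA.
exists (fun x => g x * (f x)^-1), u; split=> //.
  by apply: (smoothM oU) => //; exact: (smoothV oU).
by move=> x Ux; rewrite vE// /scalef scalerA mulfVK// f0.
Qed.

Lemma smspan_ev1r a x (B : seq (vfield R n)) v : U x ->
  (forall b, b \in B -> ev1 a (b x) = 0) -> smspan U B v -> ev1 a (v x) = 0.
Proof.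
move=> Ux aB [c [_ ->//]]; rewrite ev1_sum big1// => i _.
by rewrite ev1Z aB ?mulr0//; exact: mem_tnth.
Qed.

Lemma smspan_ev1l x u (L : seq (diff_form R n)) w : U x ->
  (forall b, b \in L -> ev1 (b x) u = 0) -> smspan U L w -> ev1 (w x) u = 0.
Proof.
move=> Ux aB [c [_ ->//]]; rewrite ev1_suml big1// => i _.
by rewrite ev1Zl aB ?mulr0//; exact: mem_tnth.
Qed.

Lemma annihilatorP (B : seq (vfield R n)) w :
  annihilator U (smspan U B) w <-> one_form U w /\
    forall b, b \in B -> forall x, U x -> ev1 (w x) (b x) = 0.
Proof.
split=> [[w1 wB]|[w1 wB]]; split=> //.
  move=> b /(tnthP (in_tuple B))[i ->] x Ux.
  by rewrite -interior_prod0 (wB _ (smspan_mem i))// ffunE.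
move=> v Bv x Ux; apply: (interior_prod_one_form w1 Ux).
by apply: (smspan_ev1r Ux _ Bv) => b bB; exact: wB.
Qed.

Lemma involutive_smooth (B : seq (vfield R n)) b :
  involutive_distribution U B -> b \in B -> smooth_vfield U b.
Proof. by move=> [sB _ _] /(tnthP (in_tuple B))[i ->]. Qed.

(** Scaling by a nonvanishing function changes neither pointwise independence nor the span, and
    closure under brackets is a property of the span. *)
Lemma Cinf_symmetry_scale (B : seq (vfield R n)) u f :
  smooth U f -> nonvanishing U f ->
  Cinf_symmetry U B u -> Cinf_symmetry U B (scalef f u).
Proof.
move=> sf f0 [sB iB iBu]; split=> //; have [_ fBu lBu] := iBu; split.
- move=> i; have := mem_tnth i (in_tuple (rcons B (scalef f u))).
  rewrite mem_rcons inE => /predU1P[->|iB'].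
    apply: (smooth_scale_vfield oU) => //.
    by apply: (involutive_smooth iBu); rewrite mem_rcons mem_head.
  exact: involutive_smooth iB iB'.
- move=> x Ux; have := fBu x Ux; rewrite !map_rcons.
  rewrite !(perm_free (introT permPl (perm_rcons _ _))).
  rewrite !free_cons => /andP[nu ->]; rewrite andbT; apply: contra nu.
  by rewrite /scalef rpredZeq (negbTE (f0 x Ux)).
- by rewrite smspan_rcons_scale.
Qed.

(** Both pairings are constant on an open set, so the two derivative terms of Cartan's formula drop
    out. The normalization of [theta] serves to reach this case. *)
Lemma cartan_formula_cst w (u v : vfield R n) (c d : R) : smooth_form U w ->
  smooth_vfield U u -> smooth_vfield U v ->
  (forall x, U x -> ev1 (w x) (u x) = c) ->
  (forall x, U x -> ev1 (w x) (v x) = d) ->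
  forall x, U x ->
    ev2 (ext_d w x) (u x) (v x) = - ev1 (w x) (lie_bracket u v x).
Proof.
move=> sw su sv wu wv x Ux; rewrite (cartan_formula sw su sv Ux).
rewrite (derive_eq_open oU (g := fun=> c) _ wu Ux).
rewrite (derive_eq_open oU (g := fun=> d) _ wv Ux).
by rewrite !derive_cst subrr sub0r.
Qed.

End smooth_spans.

(** * The frame [Z ++ X] and the ideals of [Lam w k] *)

Section related_structures.
Context (R : realType) (n r : nat) (U : set 'rV[R]_n).
Context (Z : r.-tuple (vfield R n)) (X : (n - r).-tuple (vfield R n)).
Context (w : (n - r).-tuple (diff_form R n)).
Context (rn : (r < n)%N) (oU : open U) (hX : Cinf_structure U Z X).
Context (w1 : forall k, one_form U (tnth w k)) (hrel : related U Z X w).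

Lemma rcons_Xfam (i : 'I_(n - r)) :
  rcons (Xfam Z X i) (tnth X i) = Xfam Z X i.+1.
Proof.
rewrite /Xfam (take_nth (fun=> 0)) ?size_tuple// rcons_cat.
by rewrite (tnth_nth (fun=> 0)).
Qed.

Lemma Xfam_full : Xfam Z X (n - r) = Z ++ X.
Proof. by rewrite /Xfam take_oversize// size_tuple. Qed.

Lemma involutive_full : involutive_distribution U (Z ++ X).
Proof.
(* The symmetry condition at the last index, which exists because [r < n], already concerns the
   whole family. *)
have lt : ((n - r).-1 < n - r)%N by rewrite prednK// subn_gt0.
have [_ _] := hX (Ordinal lt).
by rewrite rcons_Xfam/= prednK ?subn_gt0// Xfam_full.
Qed.

Lemma size_full : size (Z ++ X) == n.
Proof. by rewrite size_cat !size_tuple subnKC// ltnW. Qed.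

Definition frame (p : 'I_n) : vfield R n := tnth (Tuple size_full) p.

Lemma smooth_frame p : smooth_vfield U (frame p).
Proof.
exact: (involutive_smooth involutive_full (mem_tnth p (Tuple size_full))).
Qed.

Lemma frame_unitmx x : U x -> (\matrix_p frame p x) \in unitmx.
Proof.
move=> Ux; have [_ fZX _] := involutive_full.
pose s := map_tuple (fun v => v x) (Tuple size_full).
have -> : \matrix_p frame p x = \matrix_p tnth s p.
  by apply/row_matrixP => p; rewrite !rowK tnth_map.
exact/free_unitmx/fZX.
Qed.

Lemma mem_Xfam k v : v \in Xfam Z X k ->
  exists2 p : 'I_n, (p < r + k)%N & v = frame p.
Proof.
have -> : Xfam Z X k = take (r + k) (Z ++ X).
  by rewrite take_cat size_tuple ltnNge leq_addr/= addKn.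
move=> /(nthP (fun=> 0))[j]; rewrite size_take_min leq_min => /andP[jk].
rewrite (eqP size_full) => jn <-; exists (Ordinal jn) => //=.
by rewrite nth_take// /frame (tnth_nth (fun=> 0)).
Qed.

Lemma frame_mem_Xfam (p : 'I_n) k : (p < r + k)%N -> frame p \in Xfam Z X k.
Proof.
move=> pk; have -> : Xfam Z X k = take (r + k) (Z ++ X).
  by rewrite take_cat size_tuple ltnNge leq_addr/= addKn.
apply/(nthP (fun=> 0)); exists p.
  by rewrite size_take_min leq_min pk (eqP size_full) ltn_ord.
by rewrite nth_take// /frame (tnth_nth (fun=> 0)).
Qed.

Lemma Lam_ge k : (n - r <= k)%N -> Lam w k = [::].
Proof. by move=> rk; rewrite /Lam drop_oversize// size_tuple. Qed.

Lemma mem_Lam_one_form k b : b \in Lam w k -> one_form U b.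
Proof. by move=> /mem_drop /tnthP[j ->]. Qed.

(** [related] covers the levels below [n - r]; from there on [Lam w k] is empty, which settles the
    case [i.+1 = n - r] in the theorem. *)
Lemma Lam_annihilates k b v x : b \in Lam w k -> v \in Xfam Z X k -> U x ->
  ev1 (b x) (v x) = 0.
Proof.
have [nk|kn] := leqP (n - r)%N k; first by rewrite Lam_ge.
move=> /(tnthP (in_tuple _))[j ->] vX Ux; have := smspan_mem oU j.
by rewrite -hrel// => /(annihilatorP oU)[_ h]; exact: h.
Qed.

(** A dual form of index at least [r + k] vanishes on the first [r + k] members of the frame, which
    make up [Xfam Z X k]; it thus lies in the annihilator that [related] identifies with the span of
    [Lam w k]. *)
Lemma related_coframe : exists eta : 'I_n -> diff_form R n,
  [/\ forall p, one_form U (eta p),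
    forall p q x, U x -> ev1 (eta p x) (frame q x) = (q == p)%:R,
    forall i x, U x ->
      \sum_p eta p x [set i]%SET *: frame p x = delta_mx 0 i &
    forall k (p : 'I_n), (r + k <= p)%N -> smspan U (Lam w k) (eta p)].
Proof.
have [eta [eta1 dual dec]] := smooth_coframe oU smooth_frame frame_unitmx.
exists eta; split=> // k p kp.
(* The index [p] itself witnesses that [k] is in the range where [related] applies. *)
have kn : (k < n - r)%N by rewrite ltn_subRL (leq_ltn_trans kp).
rewrite -hrel//; apply/(annihilatorP oU); split=> // b /mem_Xfam[q qk ->] x Ux.
by rewrite dual//; case: eqP qk => // ->; rewrite ltnNge kp.
Qed.

(* The coframe member dual to X_i is a combination of Lam w i, all of whose members
   but w_i vanish on X_i. *)
Lemma related_pairing_neq0 (i : 'I_(n - r)) x : U x ->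
  ev1 (tnth w i x) (tnth X i x) != 0.
Proof.
move=> Ux; apply/negP => /eqP wX0.
have [eta [_ dual _ etaL]] := related_coframe.
have rin : (r + i < n)%N by rewrite -ltn_subRL.
have XE : tnth X i = frame (Ordinal rin).
  rewrite /frame !(tnth_nth (fun=> 0))/= nth_cat size_tuple ltnNge leq_addr/=.
  by rewrite addKn.
have := dual (Ordinal rin) (Ordinal rin) x Ux.
rewrite eqxx -XE (smspan_ev1l Ux _ (etaL i (Ordinal rin) (leqnn _))).
  by move/esym/eqP; rewrite oner_eq0.
move=> b; rewrite /Lam (drop_nth (fun=> 0)) ?size_tuple// -tnth_nth inE.
move=> /predU1P[->//|bL]; apply: (Lam_annihilates bL) => //.
by rewrite -rcons_Xfam mem_rcons mem_head.
Qed.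

(* Expand b in the dual coframe of Z ++ X: a term survives only if one of its
   two factors lies in Lam w k. *)
Lemma vanishing_form_ideal k b : smooth_form U b ->
  (forall x, U x -> forall S : {set 'I_n}, #|S| != 2%N -> b x S = 0) ->
  (forall u v, u \in Xfam Z X k -> v \in Xfam Z X k ->
     forall x, U x -> ev2 (b x) (u x) (v x) = 0) ->
  form_ideal U (Lam w k) b.
Proof.
move=> sb b2 bX; have [eta [eta1 _ dec etaL]] := related_coframe.
have bE x : U x -> \sum_p \sum_q scalef
    (fun y => 2^-1 * ev2 (b y) (frame p y) (frame q y))
    (wedge (eta p) (eta q)) x = b x.
  move=> Ux; apply/esym/ext_wedge_coframe; first exact: b2.
  - by move=> p S S1; have [_] := eta1 p; exact.
  - by move=> i; exact: dec.
apply: (form_ideal_eq bE); apply: form_ideal_sum => p _.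
apply: form_ideal_sum => q _.
have [pk|kp] := ltnP p (r + k); last first.
  apply: (form_ideal_scale oU).
    by apply: (smoothM oU); [exact: (smooth_cst oU)|
      apply: (smooth_ev2 oU) => //; exact: smooth_frame].
  apply: form_ideal_wedger; first by have [] := eta1 q.
  by apply: (smspan_form_ideal oU); exact: etaL.
have [qk|kq] := ltnP q (r + k); last first.
  apply: (form_ideal_scale oU).
    by apply: (smoothM oU); [exact: (smooth_cst oU)|
      apply: (smooth_ev2 oU) => //; exact: smooth_frame].
  apply: form_ideal_wedgel; first by have [] := eta1 p.
  by apply: (smspan_form_ideal oU); exact: etaL.
apply: (form_ideal_eq (a := fun=> 0)); last exact: form_ideal0.
by move=> x Ux; rewrite /scalef bX ?frame_mem_Xfam// mulr0 scale0r.
Qed.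

End related_structures.

(** * The equivalence between symmetrizing and integrating factors *)

Theorem theorem4p1 (R : realType) (n r : nat) (U : set 'rV[R]_n)
    (Z : r.-tuple (vfield R n)) (X : (n - r).-tuple (vfield R n))
    (w : (n - r).-tuple (diff_form R n))
    (hr : (r < n)%N) (hU : open U)
    (hZ : involutive_distribution U Z)
    (hX : Cinf_structure U Z X)
    (hw : Cinf_structure_forms U Z w)
    (hrel : related U Z X w)
    (i : 'I_(n - r)) (f : 'rV[R]_n -> R)
    (hf : smooth U f) (hf0 : nonvanishing U f) :
  symmetrizing_factor U (Xfam Z X i) (tnth X i) f <->
  integrating_factor U (Lam w i.+1) (tnth w i)
    (fun x => 1 / fun_of_form0 (interior_prod (scalef f (tnth X i)) (tnth w i)) x).
Proof.
have [w1 _ _ _] := hw; have hXi := hX i.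
set D := Xfam Z X i; pose Xi := tnth X i; pose wi := tnth w i.
pose fX := scalef f Xi; set mu := fun x => 1 / _.
have [_ iD iDX] := hXi; have [_ _ lD] := iD; have [_ _ lDX] := iDX.
have sX : smooth_vfield U Xi.
  by apply: (involutive_smooth iDX); rewrite mem_rcons mem_head.
have sfX : smooth_vfield U fX by exact: (smooth_scale_vfield hU).
have sD b : b \in D -> smooth_vfield U b by exact: involutive_smooth.
have swi : smooth_form U wi by case: (w1 i).
have muE x : mu x = (f x * ev1 (wi x) (Xi x))^-1.
  by rewrite /mu div1r /fun_of_form0 interior_prod0 ev1Z.
have wX0 x : U x -> ev1 (wi x) (Xi x) != 0.
  exact: (related_pairing_neq0 hr hU hX hrel).
have mu0 : nonvanishing U mu.
  by move=> x Ux; rewrite muE invr_neq0// mulf_neq0 ?wX0//; exact: hf0.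
have smu : smooth U mu.
  rewrite (_ : mu = fun x => (f x * ev1 (wi x) (Xi x))^-1); last exact/funext.
  apply: (smoothV hU).
    by move=> x Ux; rewrite mulf_neq0 ?wX0//; exact: hf0.
  by apply: (smoothM hU) => //; apply: (smooth_ev1 hU).
set theta := scalef mu wi.
have theta1 : one_form U theta by exact: (one_form_scale hU smu (w1 i)).
have stheta : smooth_form U theta by case: theta1.
have thetafX x : U x -> ev1 (theta x) (fX x) = 1.
  move=> Ux; rewrite ev1Zl ev1Z muE mulVf// mulf_neq0 ?wX0//.
  exact: hf0.
have thetaD b : b \in D -> forall x, U x -> ev1 (theta x) (b x) = 0.
  move=> bD x Ux; rewrite ev1Zl (Lam_annihilates hU hrel _ bD Ux) ?mulr0//.
  (* Indices start at 0, so [tnth w i] is the first member of [Lam w i], the family annihilating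
     [D]. *)
  by rewrite /Lam (drop_nth (fun=> 0)) ?size_tuple// -tnth_nth mem_head.
have dthetaXD b : b \in D -> forall x, U x ->
    ev2 (ext_d theta x) (fX x) (b x) = - ev1 (theta x) (lie_bracket fX b x).
  move=> bD; apply: (cartan_formula_cst hU stheta sfX (sD _ bD) thetafX).
  exact: thetaD.
have inDX b : b \in Xfam Z X i.+1 -> b = Xi \/ b \in D.
  by rewrite -rcons_Xfam mem_rcons inE => /predU1P.
have memXi : Xi \in Xfam Z X i.+1 by rewrite -rcons_Xfam mem_rcons mem_head.
split=> [[_ _ _ [_ symD]]|[_ _ dL]].
- split=> //; apply: (vanishing_form_ideal hr hU hX hrel).
  + exact: (smooth_ext_d hU).
  + by move=> x Ux S; exact: (ext_d_support hU).
  have XD b : b \in D -> forall x, U x ->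
      ev2 (ext_d theta x) (Xi x) (b x) = 0.
    (* The normalized field is [fX], whereas the ideal criterion asks about [Xi]; the nonzero factor
       [f x] passes from one to the other. *)
    move=> bD x Ux; apply: (mulfI (hf0 x Ux)).
    rewrite -ev2Zl dthetaXD// mulr0.
    have /(tnthP (in_tuple D))[j bj] := bD.
    rewrite (smspan_ev1r Ux _ (v := lie_bracket fX b) (B := D)) ?oppr0//.
      by move=> c cD; exact: thetaD.
    by rewrite bj; exact: symD.
  move=> u v /inDX[->|uD] /inDX[->|vD] x Ux.
  + exact: ev2_diag.
  + exact: XD.
  + by rewrite ev2C XD ?oppr0.
  + rewrite (cartan_formula_cst hU stheta (sD _ uD) (sD _ vD) (thetaD _ uD)
      (thetaD _ vD))//.
    rewrite (smspan_ev1r Ux _ (v := lie_bracket u v) (B := D)) ?oppr0//.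
      by move=> c cD; exact: thetaD.
    have [/(tnthP (in_tuple D))[j ->] /(tnthP (in_tuple D))[k ->]] := (uD, vD).
    by apply: lD; exact: (smspan_mem hU).
- split=> //; split; first exact: (Cinf_symmetry_scale hU).
  move=> j; set b := tnth _ j; have bD : b \in D by exact: mem_tnth.
  (* Both fields lie in the involutive span of [D] and [Xi]: [fX] with coefficient [f] on [Xi] and
     zero part in [D], and [b] with coefficient zero on [Xi]. *)
  have : smspan U (rcons D Xi) (lie_bracket fX b).
    apply: lDX; apply/(smspan_rconsP hU).
      exists f, (fun=> 0); split=> //; last by move=> x _; rewrite add0r.
      exists (fun=> fun=> 0); split=> [?|x _]; first exact: (smooth_cst hU).
      by rewrite big1// => k _; rewrite scale0r.
    exists (fun=> 0), b; split; first exact: (smooth_cst hU).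
      exact: (smspan_mem hU).
    by move=> x _; rewrite scale0r addr0.
  move=> /(smspan_rconsP hU)[g [u [_ Du lieE]]].
  apply: (smspan_eq _ Du) => x Ux; rewrite lieE//.
  (* [g] is the component of the bracket along [Xi]. Since [theta] kills the part [u] in [D], its
     value on the bracket is [g] times the nonvanishing [mu] and pairing of [wi] with [Xi]. *)
  suff -> : g x = 0 by rewrite scale0r addr0.
  have : ev2 (ext_d theta x) (fX x) (b x) = 0.
    (* Every generator in [Lam w i.+1] vanishes on [Xi], hence on [fX], and on [D], so every member
       of the ideal vanishes on the pair [fX], [b]. *)
    apply: (form_ideal_vanishing hU _ _ dL) => // c cL.
      exact: (mem_Lam_one_form w1 cL).
    move=> y Uy; split.
      by rewrite ev1Z (Lam_annihilates hU hrel cL memXi Uy) mulr0.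
    apply: (Lam_annihilates hU hrel cL) => //.
    by rewrite -rcons_Xfam mem_rcons inE bD orbT.
  rewrite dthetaXD// => /eqP; rewrite oppr_eq0 lieE// ev1D ev1Z.
  rewrite (smspan_ev1r Ux _ Du); last by move=> c cD; exact: thetaD.
  rewrite add0r ev1Zl mulf_eq0 mulf_eq0 (negbTE (mu0 x Ux)).
  by rewrite (negbTE (wX0 x Ux)) !orbF => /eqP.
Qed.
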